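(* Let $(\mathcal{J}_1,\bullet_1,B)$ be a pseudo-euclidean mock-Lie superalgebra, $(\mathcal{J}_2,\bullet_2)$ a mock-Lie superalgebra, and $\phi:\mathcal{J}_2\to\mathfrak{AnDer}_s(\mathcal{J}_1)$ a representation of mock-Lie superalgebras. Let $\varphi:\mathcal{J}_1\times\mathcal{J}_1\to\mathcal{J}_2^*$ be the even bilinear map defined by $$\varphi(x,y)(a)=(-1)^{|x|(|y|+|a|)}B\big(y,\phi(a)(x)\big)$$ for all homogeneous $x,y\in\mathcal{J}_1$ and $a\in\mathcal{J}_2$. Then $\mathcal{J}_1\oplus\mathcal{J}_2^*$ with the product $$(x+f)\bullet_c(y+g)=x\bullet_1y+\varphi(x,y)$$ is a mock-Lie superalgebra. Moreover $\phi$ can be extended to a representation $\tilde\phi$ of $\mathcal{J}_2$ with values in $\mathfrak{AnDer}(\mathcal{J}_1\oplus\mathcal{J}_2^* )$, defined by $$\tilde\phi(a)(x+f)=\phi(a)(x)+L_2^*(a)(f),$$ where $L_2^*$ is the coadjoint representation of $\mathcal{J}_2$.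
   Context: All vector spaces are finite-dimensional over a field $\mathbb{K}$ of characteristic $0$; $|x|$ denotes the degree of a homogeneous element $x$ of a $\mathbb{Z}_2$-graded space; dual spaces carry the natural grading. A mock-Lie superalgebra is a $\mathbb{Z}_2$-graded vector space $\mathcal{J}$ with an even bilinear product $\bullet$ (i.e. $\mathcal{J}_i\bullet\mathcal{J}_j\subset\mathcal{J}_{i+j}$) such that for all homogeneous $x,y,z$: $x\bullet y=(-1)^{|x||y|}y\bullet x$, and $(-1)^{|x||z|}x\bullet(y\bullet z)+(-1)^{|x||y|}y\bullet(z\bullet x)+(-1)^{|y||z|}z\bullet(x\bullet y)=0$. It is pseudo-euclidean if it is equipped with a bilinear form $B$ that is even ($B(\mathcal{J}_{\bar0},\mathcal{J}_{\bar1})=B(\mathcal{J}_{\bar1},\mathcal{J}_{\bar0})=0$), supersymmetric ($B(x,y)=(-1)^{|x||y|}B(y,x)$), non-degenerate and invariant ($B(x\bullet y,z)=B(x,y\bullet z)$). An anti-superderivation of degree $\alpha$ of $\mathcal{J}$ is $D\in\mathrm{End}(\mathcal{J})_\alpha$ with $D(x\bullet y)=-D(x)\bullet y-(-1)^{\alpha|x|}x\bullet D(y)$; $\mathfrak{AnDer}(\mathcal{J})$ is the graded space of these. $D\in \mathfrak{AnDer}(\mathcal{J})$ of degree $\alpha$ is supersymmetric with respect to $B$ if $B(D(x),y)=(-1)^{\alpha|x|}B(x,D(y))$ for all homogeneous $x$ and all $y$; $\mathfrak{AnDer}_s(\mathcal{J})$ is the graded space of supersymmetric anti-superderivations. A representation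 of $\mathcal{J}$ on a $\mathbb{Z}_2$-graded space $\mathcal{V}$ is an even linear map $\pi:\mathcal{J}\to\mathrm{End}(\mathcal{V})$ with $\pi(x\bullet y)=-\pi(x)\pi(y)-(-1)^{|x||y|}\pi(y)\pi(x)$ for homogeneous $x,y$. That $\phi:\mathcal{J}_2\to\mathfrak{AnDer}_s(\mathcal{J}_1)$ is a representation means it is a representation of $\mathcal{J}_2$ on the graded space $\mathcal{J}_1$ whose values are in $\mathfrak{AnDer}_s(\mathcal{J}_1)$ (similarly for $\tilde\phi$). The coadjoint representation is $L_2^*:\mathcal{J}_2\to\mathrm{End}(\mathcal{J}_2^* )$, $L_2^*(a)(f)=(-1)^{|f||a|}f\circ L_2(a)$, where $L_2(a)(b)=a\bullet_2b$. *)

(* Defs.v *)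
From HB Require Import structures.
From mathcomp Require Import all_boot all_order all_algebra.

Set Implicit Arguments.
Unset Strict Implicit.
Unset Printing Implicit Defensive.

Import GRing.Theory.
Local Open Scope ring_scope.

(* Degrees in Z/2 are booleans: [false] is 0, [true] is 1, the sum of degrees
   is [(+)], their product is [&&], and [(-1) ^+ b] is the associated sign. *)
Record superspace (K : fieldType) := Superspace {
  super_sort :> vectType K;
  gr : bool -> {vspace super_sort};
  gr_direct : (gr false :&: gr true = 0)%VS;
  gr_full : (gr false + gr true = fullv)%VS
}.

Section Components.
Variables (K : fieldType) (V : superspace K).
Implicit Types (x : V) (i : bool).

Definition pr i : 'End(V) := daddv_pi (gr V i) (gr V (~~ i)).

Lemma pr_mem i x : pr i x \in gr V i.
Proof. exact: memv_pi. Qed.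

Lemma gr_dir i : (gr V i :&: gr V (~~ i) = 0)%VS.
Proof. by case: i => /=; [rewrite capvC|]; exact: gr_direct. Qed.

Lemma pr_id i x : x \in gr V i -> pr i x = x.
Proof. by move=> xi; rewrite /pr daddv_pi_id // gr_dir. Qed.

Lemma pr_sum i x : pr i x + pr (~~ i) x = x.
Proof.
rewrite /pr negbK daddv_pi_add ?gr_dir //.
by case: i => /=; [rewrite addvC|]; rewrite gr_full memvf.
Qed.

Lemma pr_neg i x : x \in gr V i -> pr (~~ i) x = 0.
Proof.
by move=> xi; apply: (addrI x); rewrite -{1}(pr_id xi) pr_sum addr0.
Qed.

Lemma pr_homog i j x : x \in gr V i -> pr j x = if j == i then x else 0.
Proof.
move=> xi; case: eqP => [->|]; first exact: pr_id.
by case: i xi; case: j => // xi _; exact: (pr_neg xi).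
Qed.

End Components.

Section Dual.
Variables (K : fieldType) (V : superspace K).

Definition dual_pr i (f : 'Hom(V, K^o)) : 'Hom(V, K^o) := (f \o pr V i)%VF.

Lemma dual_pr_linear i : linear (dual_pr i).
Proof. by move=> c f g; rewrite /dual_pr comp_lfunDl comp_lfunZl. Qed.
HB.instance Definition _ i := GRing.isLinear.Build _ _ _ _ _ (dual_pr_linear i).

Definition dual_gr i : {vspace 'Hom(V, K^o)} := limg (linfun (dual_pr i)).

Lemma dual_grP i (f : 'Hom(V, K^o)) :
  (f \in dual_gr i) <-> (forall x, x \in gr V (~~ i) -> f x = 0).
Proof.
split=> [/memv_imgP[g _ ->] x xi|f0].
  by rewrite lfunE /= comp_lfunE -[i]negbK pr_neg // linear0.
apply/memv_imgP; exists f; rewrite ?memvf // lfunE /=.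
apply/lfunP=> x; rewrite comp_lfunE -{1}(pr_sum i x) linearD /=.
by rewrite (f0 (pr V (~~ i) x)) ?pr_mem // addr0.
Qed.

Lemma dual_direct : (dual_gr false :&: dual_gr true = 0)%VS.
Proof.
apply/eqP; rewrite -subv0; apply/subvP=> f; rewrite memv_cap => /andP[].
move=> /dual_grP f0 /dual_grP f1; rewrite memv0; apply/eqP/lfunP=> x.
rewrite -(pr_sum false x) linearD /= zero_lfunE.
by rewrite (f1 _ (pr_mem false x)) (f0 _ (pr_mem true x)) addr0.
Qed.

Lemma dual_full : (dual_gr false + dual_gr true = fullv)%VS.
Proof.
apply/eqP; rewrite eqEsubv subvf /=; apply/subvP=> f _.
apply/memv_addP; exists (f \o pr V false)%VF; last first.
  exists (f \o pr V true)%VF.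
    apply/dual_grP=> x xi; by rewrite comp_lfunE (pr_neg xi) linear0.
  by apply/lfunP=> x; rewrite add_lfunE !comp_lfunE -linearD (pr_sum false).
by apply/dual_grP=> x xi; rewrite comp_lfunE (pr_neg xi) linear0.
Qed.

Definition dual : superspace K := Superspace dual_direct dual_full.

End Dual.

Section DirectSum.
Variables (K : fieldType) (V W : superspace K).

Definition dsum_inl (x : V) : V * W := (x, 0).
Definition dsum_inr (y : W) : V * W := (0, y).

Lemma dsum_inl_linear : linear dsum_inl.
Proof. by move=> c x y; congr (_, _); rewrite /= scaler0 addr0. Qed.
Lemma dsum_inr_linear : linear dsum_inr.
Proof. by move=> c x y; congr (_, _); rewrite /= scaler0 addr0. Qed.
HB.instance Definition _ := GRing.isLinear.Build _ _ _ _ _ dsum_inl_linear.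
HB.instance Definition _ := GRing.isLinear.Build _ _ _ _ _ dsum_inr_linear.

Definition dsum_gr i : {vspace (V * W)%type} :=
  (linfun dsum_inl @: gr V i + linfun dsum_inr @: gr W i)%VS.

Lemma dsum_grE i (u : V * W) :
  (u \in dsum_gr i) = (u.1 \in gr V i) && (u.2 \in gr W i).
Proof.
apply/memv_addP/andP=> [[_ /memv_imgP[x xi ->] [_ /memv_imgP[y yi ->] ->]]|].
  by rewrite !lfunE /= addr0 add0r.
case: u => x y /= [xi yi]; exists (x, 0).
  by apply/memv_imgP; exists x; rewrite // lfunE.
exists (0, y); first by apply/memv_imgP; exists y; rewrite // lfunE.
by congr (_, _); rewrite /= ?addr0 ?add0r.
Qed.

Lemma dsum_direct : (dsum_gr false :&: dsum_gr true = 0)%VS.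
Proof.
apply/eqP; rewrite -subv0; apply/subvP=> -[x y]; rewrite memv_cap !dsum_grE /=.
case/andP=> /andP[x0 y0] /andP[x1 y1].
have : x \in (gr V false :&: gr V true)%VS by rewrite memv_cap x0.
have : y \in (gr W false :&: gr W true)%VS by rewrite memv_cap y0.
by rewrite !gr_direct !memv0 => /eqP-> /eqP->.
Qed.

Lemma dsum_full : (dsum_gr false + dsum_gr true = fullv)%VS.
Proof.
apply/eqP; rewrite eqEsubv subvf /=; apply/subvP=> -[x y] _.
apply/memv_addP; exists (pr V false x, pr W false y).
  by rewrite dsum_grE /= !pr_mem.
exists (pr V true x, pr W true y); first by rewrite dsum_grE /= !pr_mem.
by congr (_, _); rewrite (pr_sum false).
Qed.

Definition dsum : superspace K := Superspace dsum_direct dsum_full.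

End DirectSum.

Section MockLie.
Variables (K : fieldType) (J : superspace K).

Record mock_lie_superalgebra (mul : {bilinear J -> J -> J}) : Prop := MockLie {
  mock_lie_even : forall i j x y, x \in gr J i -> y \in gr J j ->
    mul x y \in gr J (i (+) j);
  mock_lie_comm : forall i j x y, x \in gr J i -> y \in gr J j ->
    mul x y = (-1) ^+ (i && j) *: mul y x;
  mock_lie_jacobi : forall i j k x y z,
    x \in gr J i -> y \in gr J j -> z \in gr J k ->
    (-1) ^+ (i && k) *: mul x (mul y z) + (-1) ^+ (i && j) *: mul y (mul z x)
      + (-1) ^+ (j && k) *: mul z (mul x y) = 0
}.

Record pseudo_euclidean (mul : {bilinear J -> J -> J}) (B : {biscalar J}) :
    Prop := PseudoEuclidean {
  form_even : forall i j x y, x \in gr J i -> y \in gr J j -> i != j ->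
    B x y = 0;
  form_supersymmetric : forall i j x y, x \in gr J i -> y \in gr J j ->
    B x y = (-1) ^+ (i && j) * B y x;
  form_nondegenerate : forall x, (forall y, B x y = 0) -> x = 0;
  form_invariant : forall x y z, B (mul x y) z = B x (mul y z)
}.

Definition End_degree (i : bool) (D : 'End(J)) : Prop :=
  forall j x, x \in gr J j -> D x \in gr J (i (+) j).

Definition anti_superderivation (mul : {bilinear J -> J -> J}) (i : bool)
    (D : 'End(J)) : Prop :=
  End_degree i D /\
  forall j x y, x \in gr J j ->
    D (mul x y) = - mul (D x) y - (-1) ^+ (i && j) *: mul x (D y).

Definition supersymmetric_wrt (B : {biscalar J}) (i : bool) (D : 'End(J)) :
    Prop :=
  forall j x y, x \in gr J j -> B (D x) y = (-1) ^+ (i && j) * B x (D y).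

(* The graded spaces: sums of their homogeneous parts. *)
Definition AnDer (mul : {bilinear J -> J -> J}) (D : 'End(J)) : Prop :=
  exists2 D' : bool -> 'End(J), D = D' false + D' true
    & forall i, anti_superderivation mul i (D' i).

Definition AnDer_s (mul : {bilinear J -> J -> J}) (B : {biscalar J})
    (D : 'End(J)) : Prop :=
  exists2 D' : bool -> 'End(J), D = D' false + D' true
    & forall i, anti_superderivation mul i (D' i)
                /\ supersymmetric_wrt B i (D' i).

End MockLie.

Definition representation (K : fieldType) (J V : superspace K)
    (mul : {bilinear J -> J -> J}) (pi : {linear J -> 'End(V)}) : Prop :=
  (forall i x, x \in gr J i -> End_degree i (pi x)) /\
  (forall i j x y, x \in gr J i -> y \in gr J j ->
     pi (mul x y) = - (pi x \o pi y)%VF - (-1) ^+ (i && j) *: (pi y \o pi x)%VF).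

Section Coadjoint.
Variables (K : fieldType) (J : superspace K) (mul : {bilinear J -> J -> J}).

Definition lmul (a : J) : 'End(J) := linfun (mul a).

Lemma lmul_linear : linear lmul.
Proof.
move=> c a b; apply/lfunP=> x.
by rewrite add_lfunE scale_lfunE !lfunE /= linearPl.
Qed.
HB.instance Definition _ := GRing.isLinear.Build _ _ _ _ _ lmul_linear.

(* The bilinear extension of [(-1) ^ (|f||a|) f \o lmul a], given for
   homogeneous [a] and [f]; see [coadjointE]. *)
Definition coadj_fun (a : J) (f : dual J) : dual J :=
  \sum_(i : bool) \sum_(j : bool)
    (-1) ^+ (j && i) *: (pr (dual J) j f \o lmul (pr J i a))%VF.

Lemma coadj_fun_linear a : linear (coadj_fun a).
Proof.
move=> c f g; rewrite /coadj_fun scaler_sumr -big_split; apply: eq_bigr => i _.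
rewrite /= scaler_sumr -big_split; apply: eq_bigr => j _ /=.
by rewrite linearP comp_lfunDl -comp_lfunZl scalerDr !scalerA mulrC.
Qed.
HB.instance Definition _ a :=
  GRing.isLinear.Build _ _ _ _ _ (coadj_fun_linear a).

Definition coadj_end (a : J) : 'End(dual J) := linfun (coadj_fun a).

Lemma coadj_end_linear : linear coadj_end.
Proof.
move=> c a b; apply/lfunP=> f; rewrite add_lfunE scale_lfunE !lfunE /=.
rewrite /coadj_fun scaler_sumr -big_split; apply: eq_bigr => i _.
rewrite /= scaler_sumr -big_split; apply: eq_bigr => j _ /=.
by rewrite !linearP comp_lfunDr -comp_lfunZr scalerDr !scalerA mulrC.
Qed.
HB.instance Definition _ := GRing.isLinear.Build _ _ _ _ _ coadj_end_linear.

Definition coadjoint : {linear J -> 'End(dual J)} := coadj_end.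

Lemma coadjointE i j a (f : dual J) :
  a \in gr J i -> f \in gr (dual J) j ->
  coadjoint a f = (-1) ^+ (j && i) *: (f \o lmul a)%VF.
Proof.
move=> ai fj; rewrite lfunE /= /coadj_fun (bigD1 i) //= (bigD1 j) //= big1.
  rewrite (pr_id ai) (pr_id fj) addr0 big1 ?addr0 // => k ki.
  rewrite (pr_homog _ ai) (negPf ki) linear0 big1 // => l _.
  by rewrite comp_lfun0r scaler0.
by move=> l lj; rewrite (pr_homog _ fj) (negPf lj) comp_lfun0l scaler0.
Qed.

End Coadjoint.

Section Extension.
Variables (K : fieldType) (J1 J2 : superspace K).
Variables (mul1 : {bilinear J1 -> J1 -> J1}) (B : {biscalar J1}).
Variables (mul2 : {bilinear J2 -> J2 -> J2}) (phi : {linear J2 -> 'End(J1)}).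

(* The trilinear extension of [(-1) ^ (|x|(|y| + |a|)) B (y, phi a x)], given
   for homogeneous [x], [y], [a]; see [varphiE]. *)
Definition varphi_val (x y : J1) (a : J2) : K^o :=
  \sum_(i : bool) \sum_(j : bool) \sum_(k : bool)
    (-1) ^+ (i && (j (+) k)) * B (pr J1 j y) (phi (pr J2 k a) (pr J1 i x)).

Lemma varphi_val_linear x y : linear (varphi_val x y).
Proof.
move=> c a b; rewrite /varphi_val scaler_sumr -big_split.
apply: eq_bigr => i _; rewrite /= scaler_sumr -big_split.
apply: eq_bigr => j _; rewrite /= scaler_sumr -big_split.
apply: eq_bigr => k _ /=.
by rewrite !linearP add_lfunE scale_lfunE linearPr mulrDr mulrCA.
Qed.
HB.instance Definition _ x y :=
  GRing.isLinear.Build _ _ _ _ _ (varphi_val_linear x y).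

Definition varphi_fun (x y : J1) : dual J2 := linfun (varphi_val x y).

Lemma varphi_fun_bilinear : bilinear_for *:%R *:%R varphi_fun.
Proof.
split=> [y c x x'|x c y y']; apply/lfunP=> a;
  rewrite add_lfunE scale_lfunE !lfunE /= /varphi_val scaler_sumr -big_split;
  apply: eq_bigr => i _; rewrite /= scaler_sumr -big_split;
  apply: eq_bigr => j _; rewrite /= scaler_sumr -big_split;
  apply: eq_bigr => k _ /=.
  by rewrite !linearP /= mulrDr mulrCA.
by rewrite linearP linearPl mulrDr mulrCA.
Qed.
HB.instance Definition _ :=
  bilinear_isBilinear.Build _ _ _ _ _ _ varphi_fun varphi_fun_bilinear.

Definition varphi : {bilinear J1 -> J1 -> dual J2} := varphi_fun.

Lemma varphiE i j k x y a :
  x \in gr J1 i -> y \in gr J1 j -> a \in gr J2 k ->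
  varphi x y a = (-1) ^+ (i && (j (+) k)) * B y (phi a x).
Proof.
move=> xi yj ak; rewrite lfunE /= /varphi_val.
rewrite (bigD1 i) //= (bigD1 j) //= (bigD1 k) //=.
rewrite (pr_id xi) (pr_id yj) (pr_id ak) !big1 ?addr0 //.
- move=> l lk; rewrite (pr_homog _ xi) (negPf lk) big1 // => m _.
  by rewrite big1 // => n _; rewrite linear0 linear0r mulr0.
- move=> l lk; rewrite (pr_homog _ yj) (negPf lk) big1 // => m _.
  by rewrite linear0l mulr0.
by move=> l lk; rewrite (pr_homog _ ak) (negPf lk) linear0 zero_lfunE
  linear0r mulr0.
Qed.

Lemma varphi_even : pseudo_euclidean mul1 B -> representation mul2 phi ->
  forall i j x y, x \in gr J1 i -> y \in gr J1 j ->
    varphi x y \in gr (dual J2) (i (+) j).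
Proof.
move=> [Bev _ _ _] [phiev _] i j x y xi yj; apply/dual_grP=> a ak.
rewrite (varphiE xi yj ak) (Bev j (~~ (i (+) j) (+) i)) ?mulr0 //.
  exact: phiev ak _ _ xi.
by case: (i); case: (j).
Qed.

Definition ext_mul_fun (u v : dsum J1 (dual J2)) : dsum J1 (dual J2) :=
  (mul1 u.1 v.1, varphi u.1 v.1).

Lemma ext_mul_bilinear : bilinear_for *:%R *:%R ext_mul_fun.
Proof.
by split=> [v c u u'|u c v v']; congr (_, _); rewrite /= ?linearPl ?linearPr.
Qed.
HB.instance Definition _ :=
  bilinear_isBilinear.Build _ _ _ _ _ _ ext_mul_fun ext_mul_bilinear.

Definition ext_mul :
    {bilinear dsum J1 (dual J2) -> dsum J1 (dual J2) -> dsum J1 (dual J2)} :=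
  ext_mul_fun.

Definition ext_rep_fun (a : J2) (u : dsum J1 (dual J2)) : dsum J1 (dual J2) :=
  (phi a u.1, coadjoint mul2 a u.2).

Lemma ext_rep_fun_linear a : linear (ext_rep_fun a).
Proof. by move=> c u v; congr (_, _); rewrite /= linearP. Qed.
HB.instance Definition _ a :=
  GRing.isLinear.Build _ _ _ _ _ (ext_rep_fun_linear a).

Definition ext_rep_end (a : J2) : 'End(dsum J1 (dual J2)) :=
  linfun (ext_rep_fun a).

Lemma ext_rep_end_linear : linear ext_rep_end.
Proof.
move=> c a b; apply/lfunP=> u; rewrite add_lfunE scale_lfunE !lfunE /=.
by congr (_, _); rewrite /= linearP add_lfunE scale_lfunE.
Qed.
HB.instance Definition _ := GRing.isLinear.Build _ _ _ _ _ ext_rep_end_linear.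

Definition ext_rep : {linear J2 -> 'End(dsum J1 (dual J2))} := ext_rep_end.

Lemma ext_repE a x (f : dual J2) :
  ext_rep a (x, f) = (phi a x, coadjoint mul2 a f).
Proof. by rewrite lfunE. Qed.

End Extension.

(* Main.v *)
Require Import Defs.
From mathcomp Require Import all_boot all_order all_algebra.
From mathcomp Require Import ring.

Set Implicit Arguments.
Unset Strict Implicit.
Unset Printing Implicit Defensive.

Import GRing.Theory.
Local Open Scope ring_scope.

(* By parity, the form of the cocycle simplifies to
   varphi(x, y)(a) = (-1)^|a| B(phi(a) x, y) for homogeneous a and arbitrary x, y,
   since B(phi(a) x, y) vanishes unless |a| + |x| + |y| = 0. In this form its
   supersymmetry is that of phi(a), its Jacobi identity comes from evaluating
   B(phi(a)(x y), z) once with the anti-superderivation rule and once with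
   B(phi(a)(x y), z) = (-1)^(|a|(|x| + |y|)) B(x y, phi(a) z), and its
   compatibility with phi and the coadjoint representation is the
   representation rule for phi(a b). *)

Section Homogeneous.
Variables (K : fieldType) (V : superspace K).

Lemma homog_eq_lfun (W : vectType K) (f g : 'Hom(V, W)) :
  (forall i x, x \in gr V i -> f x = g x) -> f = g.
Proof.
move=> fg; apply/lfunP=> x; rewrite -(pr_sum false x) !linearD /=.
by rewrite (fg _ _ (pr_mem false x)) (fg _ _ (pr_mem true x)).
Qed.

Lemma homog_eq0 i (x : V) : x \in gr V i -> x \in gr V (~~ i) -> x = 0.
Proof.
move=> xi xNi; apply/eqP; rewrite -memv0.
by rewrite -(gr_dir V i) memv_cap xi.
Qed.

(** The definition leaves the second argument arbitrary; splitting it into components makes its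
    degree available when signs are compared. *)
Lemma anti_superderivation_homog (mul : {bilinear V -> V -> V}) i D :
  End_degree i D ->
  (forall j k x y, x \in gr V j -> y \in gr V k ->
     D (mul x y) = - mul (D x) y - (-1) ^+ (i && j) *: mul x (D y)) ->
  anti_superderivation mul i D.
Proof.
move=> Di DM; split=> // j x y xj; rewrite -(pr_sum false y).
rewrite !(linearDr, linearD) /= (DM _ _ _ _ xj (pr_mem false y)).
by rewrite (DM _ _ _ _ xj (pr_mem true y)) addrACA.
Qed.

(** Here [D - D' i] is the other component [D' (~~ i)], so it sends homogeneous vectors into both
    graded parts at once and vanishes. This gives the signed rules for [phi a] when [a] is
    homogeneous. *)
Lemma AnDer_s_homog (mul : {bilinear V -> V -> V}) (B : {biscalar V}) i D :
  End_degree i D -> AnDer_s mul B D ->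
  anti_superderivation mul i D /\ supersymmetric_wrt B i D.
Proof.
move=> Di [D' defD D'P]; suff ->: D = D' i by exact: D'P.
apply: homog_eq_lfun => j x xj; apply/eqP; rewrite -subr_eq0; apply/eqP.
have [[D'i _] _] := D'P i; have [[D'Ni _] _] := D'P (~~ i).
apply: (@homog_eq0 (i (+) j)); first by rewrite rpredB ?Di ?D'i.
suff ->: D x - D' i x = D' (~~ i) x by rewrite -addNb D'Ni.
rewrite defD add_lfunE; case: (i); first by rewrite addrK.
by rewrite addrC addKr.
Qed.

End Homogeneous.

Section Coadjoint.
Variables (K : fieldType) (J : superspace K) (mul : {bilinear J -> J -> J}).

Lemma coadjoint_degree i a : mock_lie_superalgebra mul ->
  a \in gr J i -> End_degree i (coadjoint mul a).
Proof.
move=> [mulE _ _] ai j f fj; rewrite (coadjointE mul ai fj) memvZ //.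
apply/dual_grP=> x xk; rewrite comp_lfunE lfunE /=.
move/dual_grP: fj; apply.
have := mulE _ _ _ _ ai xk; by case: (i); case: (j).
Qed.

(** The Jacobi identity on [a], [b], [c], read as the representation rule for left
    multiplication. *)
Lemma mock_lie_lmul i j a b : mock_lie_superalgebra mul ->
  a \in gr J i -> b \in gr J j ->
  lmul mul (mul a b) = - (lmul mul a \o lmul mul b)%VF
    - (-1) ^+ (i && j) *: (lmul mul b \o lmul mul a)%VF.
Proof.
move=> [mulE mulC mulJ] ai bj; apply: homog_eq_lfun => k c ck.
rewrite !(add_lfunE, opp_lfunE, scale_lfunE, comp_lfunE, lfunE) /=.
rewrite (mulC _ _ _ _ (mulE _ _ _ _ ai bj) ck).
have := mulJ _ _ _ _ _ _ ai bj ck; rewrite (mulC _ _ _ _ ck ai) linearZr /=.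
move/eqP; rewrite addr_eq0 => /eqP E.
(* This factor gives [mul c (mul a b)] the sign [j && k] that it has in the Jacobi identity. *)
apply: (scalerI (a := (-1) ^+ (i && k))); first by rewrite signr_eq0.
rewrite scalerBr scalerN scalerA -signr_addb.
have -> : (i && k) (+) (i (+) j) && k = j && k by case: (i); case: (j); case: (k).
rewrite -[LHS]opprK -E opprD !scalerA.
by rewrite [in RHS]mulrC [k && i]andbC.
Qed.

(** Precomposition reverses the order of operators, so the two terms of [mock_lie_lmul] trade
    places; the signs in [coadjointE] compensate. *)
Lemma coadjoint_rep : mock_lie_superalgebra mul ->
  representation mul (coadjoint mul).
Proof.
move=> ml; split=> [i a|i j a b ai bj]; first exact: coadjoint_degree.
have [mulE _ _] := ml; apply: homog_eq_lfun => k f fk.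
rewrite !(add_lfunE, opp_lfunE, scale_lfunE, comp_lfunE).
rewrite (coadjointE mul (mulE _ _ _ _ ai bj) fk) (mock_lie_lmul ml ai bj).
rewrite (coadjointE mul ai (coadjoint_degree ml bj fk)).
rewrite (coadjointE mul bj (coadjoint_degree ml ai fk)).
rewrite (coadjointE mul ai fk) (coadjointE mul bj fk); apply/lfunP=> x.
rewrite !(add_lfunE, opp_lfunE, scale_lfunE, comp_lfunE) linearB linearN linearZ /=.
set P := f _; set Q := f _; rewrite /GRing.scale /=.
by case: (i); case: (j); case: (k) => /=; rewrite ?(expr0, expr1); ring.
Qed.

End Coadjoint.

Section Extension.
Variables (K : fieldType) (J1 J2 : superspace K).
Variables (mul1 : {bilinear J1 -> J1 -> J1}) (B : {biscalar J1}).
Variables (mul2 : {bilinear J2 -> J2 -> J2}) (phi : {linear J2 -> 'End(J1)}).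
Hypothesis ml1 : mock_lie_superalgebra mul1.
Hypothesis pe1 : pseudo_euclidean mul1 B.
Hypothesis ml2 : mock_lie_superalgebra mul2.
Hypothesis rep_phi : representation mul2 phi.
Hypothesis phi_AnDer : forall a, AnDer_s mul1 B (phi a).

Lemma varphi_form k a x y : a \in gr J2 k ->
  varphi B phi x y a = (-1) ^+ k * B (phi a x) y.
Proof.
move=> ak; have [Bev Bsym _ _] := pe1; have [phiev _] := rep_phi.
have homog i j u v : u \in gr J1 i -> v \in gr J1 j ->
    varphi B phi u v a = (-1) ^+ k * B (phi a u) v.
  move=> ui vj; rewrite (varphiE _ _ ui vj ak).
  have pu := phiev _ _ ak _ _ ui; rewrite (Bsym _ _ _ _ pu vj).
  (* For [j = k (+) i] the exponents from [varphiE] and from supersymmetry are [i] and [k (+) i],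
     with sum [k]. *)
  case: (eqVneq j (k (+) i)) => [->|ne]; last by rewrite (Bev _ _ _ _ vj pu) ?mulr0.
  by rewrite mulrA -signr_addb; case: (i); case: (k).
rewrite -(pr_sum false x) -(pr_sum false y).
rewrite !(linearDl, linearDr, linearD) /= !add_lfunE.
rewrite !(homog _ _ _ _ (pr_mem _ x) (pr_mem _ y)).
by rewrite -!mulrDr addrACA.
Qed.

Lemma varphi_comm i j x y : x \in gr J1 i -> y \in gr J1 j ->
  varphi B phi x y = (-1) ^+ (i && j) *: varphi B phi y x.
Proof.
move=> xi yj; apply: homog_eq_lfun => k a ak; rewrite scale_lfunE.
rewrite !(varphi_form _ _ ak); have [_ Bsym _ _] := pe1.
have [phiev _] := rep_phi.
have [_ sD] := AnDer_s_homog (phiev _ _ ak) (phi_AnDer a).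
rewrite (sD _ _ _ xi) (Bsym _ _ _ _ xi (phiev _ _ ak _ _ yj)).
rewrite /GRing.scale /= !mulrA -!signr_addb.
by case: (i); case: (j); case: (k).
Qed.

Lemma varphi_jacobi i j k x y z :
  x \in gr J1 i -> y \in gr J1 j -> z \in gr J1 k ->
  (-1) ^+ (i && k) *: varphi B phi x (mul1 y z)
  + (-1) ^+ (i && j) *: varphi B phi y (mul1 z x)
  + (-1) ^+ (j && k) *: varphi B phi z (mul1 x y) = 0.
Proof.
move=> xi yj zk; apply: homog_eq_lfun => l a al.
rewrite !(add_lfunE, scale_lfunE, zero_lfunE) !(varphi_form _ _ al).
have [Bev Bsym _ Binv] := pe1; have [phiev _] := rep_phi.
have [mulE mulC _] := ml1.
have D_deg := phiev _ _ al.
have [[_ aD] sD] := AnDer_s_homog D_deg (phi_AnDer a).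
have xy := mulE _ _ _ _ xi yj.
have E1 : B (phi a (mul1 x y)) z
    = - B (phi a x) (mul1 y z)
      - (-1) ^+ (l && i) * B x (mul1 (phi a y) z).
  by rewrite (aD _ _ _ xi) linearBl linearNl linearZl_LR /= !Binv.
have E2 : B (phi a (mul1 x y)) z
    = (-1) ^+ ((i && k) (+) (j && k)) * B (phi a z) (mul1 x y).
  rewrite (sD _ _ _ xy) (Bsym _ _ _ _ xy (D_deg _ _ zk)) mulrA -signr_addb.
  by case: (i); case: (j); case: (k); case: (l).
have E3 : B x (mul1 (phi a y) z)
    = (-1) ^+ ((i && j) (+) (i && l) (+) (i && k)) * B (phi a y) (mul1 z x).
  rewrite (Bsym _ _ _ _ xi (mulE _ _ _ _ (D_deg _ _ yj) zk)) Binv.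
  by case: (i); case: (j); case: (k); case: (l).
move: E1; rewrite E2 E3 /GRing.scale /=.
set P := B (phi a x) _; set Q := B (phi a y) _; set R := B (phi a z) _.
move=> E.
suff S : (-1) ^+ (i && k) * P + (-1) ^+ (i && j) * Q + (-1) ^+ (j && k) * R = 0.
  by rewrite ![_ * ((-1) ^+ l * _)]mulrCA -!mulrDr S mulr0.
(* The sign is split so that the left side of [E] appears and [R] can be eliminated. *)
have -> : (-1) ^+ (j && k) * R =
    (-1) ^+ (i && k) * ((-1) ^+ ((i && k) (+) (j && k)) * R).
  by rewrite mulrA -signr_addb addKb.
rewrite E; case: (i); case: (j); case: (k); case: (l) => /=;
  rewrite ?(expr0, expr1); ring.
Qed.

(** The product does not see the dual components, so each axiom splits into that of [mul1] and the
    matching property of the cocycle. *)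
Lemma ext_mul_mock_lie : mock_lie_superalgebra (ext_mul mul1 B phi).
Proof.
have [mulE mulC mulJ] := ml1; split.
- move=> i j u v; rewrite !dsum_grE => /andP[ui _] /andP[vj _] /=.
  by rewrite mulE //= (varphi_even pe1 rep_phi).
- move=> i j u v; rewrite !dsum_grE => /andP[ui _] /andP[vj _].
  by congr (_, _); [exact: mulC | exact: varphi_comm].
move=> i j k u v w; rewrite !dsum_grE => /andP[ui _] /andP[vj _] /andP[wk _].
by congr (_, _); [exact: mulJ | exact: varphi_jacobi].
Qed.

Lemma ext_rep_representation : representation mul2 (ext_rep mul2 phi).
Proof.
have [phiE phiM] := rep_phi; have [coE coM] := coadjoint_rep ml2.
split=> [i a ai j [x f]|i j a b ai bj].
  by rewrite ext_repE !dsum_grE /= => /andP[/(phiE _ _ ai)-> /(coE _ _ ai)->].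
apply/lfunP=> -[x f].
rewrite !(add_lfunE, opp_lfunE, scale_lfunE, comp_lfunE, ext_repE).
by congr (_, _); rewrite /= ?(phiM _ _ _ _ ai bj) ?(coM _ _ _ _ ai bj)
  !(add_lfunE, opp_lfunE, scale_lfunE, comp_lfunE).
Qed.

(** The dual component of the anti-superderivation rule for [ext_rep]; the first component is the
    rule for [phi a]. *)
Lemma coadjoint_varphi i j l a x y :
  a \in gr J2 l -> x \in gr J1 i -> y \in gr J1 j ->
  coadjoint mul2 a (varphi B phi x y) =
    - varphi B phi (phi a x) y - (-1) ^+ (l && i) *: varphi B phi x (phi a y).
Proof.
move=> al xi yj; apply: homog_eq_lfun => m b bm.
have [Bev _ _ _] := pe1; have [phiE phiM] := rep_phi; have [mulE _ _] := ml2.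
rewrite (coadjointE mul2 al (varphi_even pe1 rep_phi xi yj)).
rewrite !(add_lfunE, opp_lfunE, scale_lfunE, comp_lfunE, lfunE (mul2 a)) /=.
rewrite (varphi_form _ _ (mulE _ _ _ _ al bm)) !(varphi_form _ _ bm).
rewrite (phiM _ _ _ _ al bm) !(add_lfunE, opp_lfunE, scale_lfunE, comp_lfunE).
rewrite linearBl linearNl linearZl_LR /=.
have [_ sD] := AnDer_s_homog (phiE _ _ al) (phi_AnDer a).
have bx := phiE _ _ bm _ _ xi; have ax := phiE _ _ al _ _ xi.
have -> : B (phi b x) (phi a y)
    = (-1) ^+ (l && (m (+) i)) * B (phi a (phi b x)) y.
  by rewrite (sD _ _ _ bx) mulrA -signr_addb addbb mul1r.
(* The sign on the left involves [j], which parity determines: for any other [j] both values of [B]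
   vanish. *)
case: (eqVneq (l (+) (m (+) i)) j) => [<-|ne].
  set P := B _ y; set Q := B _ y; rewrite /GRing.scale /=.
  by case: (i); case: (l); case: (m) => /=; rewrite ?(expr0, expr1); ring.
rewrite (Bev _ _ _ _ (phiE _ _ al _ _ bx) yj ne).
rewrite (Bev _ _ _ _ (phiE _ _ bm _ _ ax) yj); last by rewrite addbCA.
by rewrite !(mulr0, scaler0, oppr0, addr0).
Qed.

Lemma ext_rep_AnDer a : AnDer (ext_mul mul1 B phi) (ext_rep mul2 phi a).
Proof.
(* As [ext_rep] is even, the components of [a] act as the components of its operator. *)
exists (fun i => ext_rep mul2 phi (pr J2 i a)).
  by rewrite -linearD (pr_sum false).
move=> l; have al := pr_mem l a; have [extE _] := ext_rep_representation.
have [phiE _] := rep_phi.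
have [[_ aD] _] := AnDer_s_homog (phiE _ _ al) (phi_AnDer _).
apply: anti_superderivation_homog; first exact: extE.
move=> i j [x f] [y g]; rewrite !dsum_grE /= => /andP[xi _] /andP[yj _].
rewrite !ext_repE.
by congr (_, _); [exact: aD | exact: (coadjoint_varphi al xi yj)].
Qed.

End Extension.

Theorem theorem4p1 (K : fieldType) (K_char0 : [pchar K] =i pred0)
    (J1 J2 : superspace K)
    (mul1 : {bilinear J1 -> J1 -> J1}) (B : {biscalar J1})
    (mul2 : {bilinear J2 -> J2 -> J2}) (phi : {linear J2 -> 'End(J1)}) :
  mock_lie_superalgebra mul1 -> pseudo_euclidean mul1 B ->
  mock_lie_superalgebra mul2 ->
  representation mul2 phi -> (forall a, AnDer_s mul1 B (phi a)) ->
  mock_lie_superalgebra (ext_mul mul1 B phi) /\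
  (representation mul2 (ext_rep mul2 phi) /\
   forall a, AnDer (ext_mul mul1 B phi) (ext_rep mul2 phi a)).
Proof.
move=> ml1 pe1 ml2 rep_phi phi_AnDer.
split; first exact: (ext_mul_mock_lie ml1 pe1 rep_phi).
by split=> [|a]; [exact: ext_rep_representation | exact: ext_rep_AnDer].
Qed.
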